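(* Let $k$ be a positive integer, and suppose $H$ is a subgraph of a graph $G$. If $G$ is proportionally $k$-choosable, then $H$ is proportionally $k$-choosable.
   Context: All graphs are finite and simple. Subgraphs are not required to be induced or spanning. For a positive integer $k$, a $k$-assignment $L$ for a graph $G$ assigns to each vertex $v$ a set $L(v)$ of exactly $k$ colors; its palette is $\mathcal{L} = \bigcup_{v \in V(G)} L(v)$, and for $c \in \mathcal{L}$, $\eta(c) = |\{v \in V(G) : c \in L(v)\}|$. A proper $L$-coloring of $G$ is a proper coloring $f$ of $G$ with $f(v) \in L(v)$ for every vertex $v$. It is a proportional $L$-coloring if for every $c \in \mathcal{L}$, $|f^{-1}(c)|$ equals $\lfloor \eta(c)/k \rfloor$ or $\lceil \eta(c)/k \rceil$. $G$ is proportionally $k$-choosable if a proportional $L$-coloring of $G$ exists for every $k$-assignment $L$ for $G$. *)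

(* Defs.v *)
From mathcomp Require Import all_boot all_order all_algebra.

Set Implicit Arguments.
Unset Strict Implicit.
Unset Printing Implicit Defensive.

Import GRing.Theory Num.Theory.

(* A finite simple graph whose vertices lie in an ambient finite type [T], so
   that two graphs over the same [T] can be compared by inclusion. *)
Record sgraph (T : finType) := SGraph {
  vertices : {set T};
  adj : rel T;
  adj_sym : symmetric adj;
  adj_irrefl : irreflexive adj;
  adj_vertices : forall x y, adj x y -> (x \in vertices) && (y \in vertices)
}.

Definition subgraph (T : finType) (H G : sgraph T) : Prop :=
  vertices H \subset vertices G /\ subrel (adj H) (adj G).

(* Lists and colorings are functions on this type, not on [T]: the null graph
   then has a coloring even when there are no colors at all. *)
Definition vertex (T : finType) (G : sgraph T) : finType :=
  {x : T | x \in vertices G}.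

Definition assignment (T C : finType) (G : sgraph T) (k : nat)
    (L : vertex G -> {set C}) : Prop :=
  forall v, #|L v| = k.

Definition palette (T C : finType) (G : sgraph T) (L : vertex G -> {set C}) :
    {set C} :=
  \bigcup_(v : vertex G) L v.

Definition eta (T C : finType) (G : sgraph T) (L : vertex G -> {set C})
    (c : C) : nat :=
  #|[set v | c \in L v]|.

Definition proper_list_coloring (T C : finType) (G : sgraph T)
    (L : vertex G -> {set C}) (f : vertex G -> C) : Prop :=
  (forall u v, adj G (val u) (val v) -> f u <> f v) /\
  (forall v, f v \in L v).

Definition proportional_coloring (T C : finType) (G : sgraph T) (k : nat)
    (L : vertex G -> {set C}) (f : vertex G -> C) : Prop :=
  proper_list_coloring L f /\
  forall c, c \in palette L ->
    let m := Posz #|[set v | f v == c]| in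
    let q : rat := ((eta L c)%:Q / k%:Q)%R in
    m = Num.floor q \/ m = Num.ceil q.

(* The colors of any assignment form a finite set, so letting [C] range over
   all finite types covers every assignment; [C] may strictly contain the
   palette. *)
Definition proportionally_choosable (T : finType) (k : nat) (G : sgraph T) :
    Prop :=
  forall (C : finType) (L : vertex G -> {set C}), assignment k L ->
    exists f : vertex G -> C, proportional_coloring k L f.

(* Main.v *)
Require Import Defs.
From mathcomp Require Import all_boot all_order all_algebra.

Set Implicit Arguments.
Unset Strict Implicit.
Unset Printing Implicit Defensive.

(* A list assignment of H extends to G by giving every vertex v outside H the
   k private colors (v, i), i < k. The old colors then occur only in lists of
   vertices of H, so neither their multiplicities nor their color classes change
   when a proportional coloring of G is restricted to H. *)

Section Extension.
Variables (T C : finType) (k : nat) (G H : sgraph T).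
Hypothesis sub_vert : vertices H \subset vertices G.
Variable L : vertex H -> {set C}.

Definition vertex_incl (u : vertex H) : vertex G :=
  exist _ (val u) (subsetP sub_vert _ (valP u)).

(** [insub] both tests whether [v] lies in [H] and returns it as a [vertex H], to which [L]
    applies. *)
Definition extend_lists (v : vertex G) : {set C + T * 'I_k} :=
  if insub (val v) is Some u then inl @: L u
  else [set inr (val v, i) | i : 'I_k].

Lemma vertex_incl_inj : injective vertex_incl.
Proof. by move=> u v /(congr1 val) /= /val_inj. Qed.

Lemma extend_lists_incl u : extend_lists (vertex_incl u) = inl @: L u.
Proof. by rewrite /extend_lists /= valK. Qed.

Lemma extend_lists_assignment : assignment k L -> assignment k extend_lists.
Proof.
move=> cardL v; rewrite /extend_lists; case: insubP => [u _ _ | _].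
  by rewrite card_imset ?cardL //; apply: inl_inj.
by rewrite card_imset ?card_ord // => i j [].
Qed.

(** Private colors are tagged [inr], so an old color can only come from a list inherited from
    [H]. *)
Lemma inl_in_extend_lists c v :
  inl c \in extend_lists v -> exists2 u, v = vertex_incl u & c \in L u.
Proof.
rewrite /extend_lists; case: insubP => [u _ uv | _] /imsetP[] // d dLu [->].
by exists u => //; apply: val_inj.
Qed.

Lemma eta_extend_lists c : eta extend_lists (inl c) = eta L c.
Proof.
rewrite /eta -(card_imset _ vertex_incl_inj); congr #|pred_of_set _|.
apply/setP=> v; rewrite inE; apply/idP/imsetP.
  by move=> /inl_in_extend_lists[u -> cLu]; exists u; rewrite ?inE.
by move=> [u]; rewrite inE => cLu ->; rewrite extend_lists_incl imset_f.
Qed.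

Lemma inl_in_palette c :
  c \in palette L -> inl c \in palette extend_lists.
Proof.
move=> /bigcupP[u _ cLu]; apply/bigcupP; exists (vertex_incl u) => //.
by rewrite extend_lists_incl imset_f.
Qed.

(** A vertex colored [inl c] has [inl c] in its list, hence lies in [H]; the class in [G] is thus
    the injective image of the class in [H]. *)
Lemma card_color_class_restrict (f : vertex G -> C + T * 'I_k)
    (g : vertex H -> C) c :
    (forall v, f v \in extend_lists v) ->
    (forall u, f (vertex_incl u) = inl (g u)) ->
  #|[set v | f v == inl c]| = #|[set u | g u == c]|.
Proof.
move=> fL fg; rewrite -[RHS](card_imset _ vertex_incl_inj).
congr #|pred_of_set _|; apply/setP=> v; rewrite inE; apply/eqP/imsetP.
  move=> fv; have := fL v; rewrite fv => /inl_in_extend_lists[u vE _].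
  by exists u => //; move: fv; rewrite vE fg inE => -[->].
by move=> [u]; rewrite inE => /eqP <- ->.
Qed.

End Extension.

Theorem proposition21 (T : finType) (k : nat) (G H : sgraph T)
    (k_gt0 : 0 < k) (subHG : subgraph H G)
    (chG : proportionally_choosable k G) : proportionally_choosable k H.
Proof.
move=> C L cardL; have [sub_vert sub_adj] := subHG.
have [f [[f_proper fL] f_prop]] :=
  chG _ _ (@extend_lists_assignment _ _ k G _ _ cardL).
pose incl := @vertex_incl _ G H sub_vert.
(* The color is extracted as a sigma type, so that [g] needs no default color: [C] may be empty when
   [H] has no vertices. *)
have f_inl u : {c | f (incl u) = inl c}.
  case fu: (f (incl u)) => [c | d]; first by exists c.
  by exfalso; move: (fL (incl u)); rewrite extend_lists_incl fu => /imsetP[].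
pose g u := sval (f_inl u).
have fg u : f (incl u) = inl (g u) := svalP (f_inl u).
exists g; split; first split.
- move=> u v /sub_adj uv guv.
  by apply: (f_proper (incl u) (incl v) uv); rewrite !fg guv.
- move=> u; have := fL (incl u).
  by rewrite extend_lists_incl fg mem_imset //; apply: inl_inj.
(* The condition on [f] at [inl c] becomes the goal once the class size and the multiplicity are
   rewritten to those in [H]; [k] is the same. *)
- move=> c /(inl_in_palette k sub_vert)/f_prop.
  by rewrite (card_color_class_restrict _ fL fg) (eta_extend_lists _ sub_vert).
Qed.
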